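(* In the two-stage school choice model with preparatory actions, the Student-Proposing Deferred Acceptance mechanism (DA) eliminates justified envy, but it does not eliminate invariant justified envy.
   Context: Model. An economy consists of a finite set $\mathcal{I}$ of students, a finite set $\mathcal{S}$ of schools, a finite capacity $C_s$ for each $s\in\mathcal{S}$, a manipulability level $w\in[0,1]$, a deception cost $\gamma>0$, and for each student $i$: an action set $A_i$ with $|A_i|\ge 2$ and a distinguished null action $a_i^0\in A_i$; utilities $v_{i,s}\in\mathbb{R}$ inducing strict ordinal preferences over $\mathcal{S}$ (being unmatched gives utility $0$); non-manipulable scores $p^{exog}_{i,s}\in[0,1]$; and functions $p^{manip}_{i,s}:A_i\to[0,1]$. In stage one each student $i$ chooses a preparatory action $a_i\in A_i$. The realized priority of $i$ at $s$ is $$p_{i,s}(a_i)=w\,p^{manip}_{i,s}(a_i)+(1-w)\,p^{exog}_{i,s}.$$ In stage two a mechanism maps the students' rank order lists, the capacities and the realized priorities (higher score means higher priority; ties are broken by a fixed exogenous strict order on students) to a matching $\mu:\mathcal{I}\to\mathcal{S}\cup\{\emptyset\}$ with at most $C_s$ students at each $s$. DA: in each round every currently unheld student proposes to the best listed school that has not yet rejected her; each school tentatively holds the highest-priority students among those it currently holds and its new proposers, up to capacity, and rejects the rest; the procedure stops when there are no new rejections, and tentative assignments become final. A mechanism eliminates justified envy if in every economy, for every profile of preferences and every profile of actions $(a_i)_i$ with its realized priorities $p_{i,s}(a_i)$, the matching $\mu$ the mechanism produces from these preferences and realized priorities admits no pair $(i,s)$ such that $i$ prefers $s$ to $\mu(i)$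 (where $\emptyset$ is ranked as utility $0$) and either $s$ has a vacant seat under $\mu$ or $i$'s realized priority at $s$ is strictly higher than that of some student matched to $s$. A mechanism eliminates invariant justified envy if the same holds when, in the envy condition, students' priorities are compared under the assumption $w=0$, i.e. using $p^{exog}_{\cdot,s}$ in place of the realized priorities (the matching $\mu$ itself still being produced from the realized priorities). *)

(* Defs.v *)
From HB Require Import structures.
From mathcomp Require Import all_boot all_order all_algebra.
From mathcomp Require Import reals.

Set Implicit Arguments.
Unset Strict Implicit.
Unset Printing Implicit Defensive.

Import Order.TTheory GRing.Theory Num.Theory.
Local Open Scope ring_scope.

Record economy (R : realType) := Economy {
  student : finType;
  school : finType;
  capacity : school -> nat;
  manip_level : R;
  deception_cost : R;
  (* action sets need not be finite *)
  action : student -> Type;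
  null_action : forall i, action i;
  utility : student -> school -> R;
  exog_score : student -> school -> R;
  manip_score : forall i, school -> action i -> R;
  manip_level01 : 0 <= manip_level <= 1;
  deception_cost_gt0 : 0 < deception_cost;
  action_ge2 : forall i, exists a b : action i, a <> b;
  utility_strict : forall i, injective (utility i);
  exog_score01 : forall i s, 0 <= exog_score i s <= 1;
  manip_score01 : forall i s (a : action i), 0 <= manip_score s a <= 1
}.

Definition action_profile (R : realType) (E : economy R) : Type :=
  forall i : student E, action i.

Definition realized_priority (R : realType) (E : economy R)
    (a : action_profile E) (i : student E) (s : school E) : R :=
  manip_level E * manip_score s (a i) + (1 - manip_level E) * exog_score i s.

(* The acceptable schools (better than being unmatched, which is worth 0), from
   best to worst. *)
Definition rank_order_list (R : realType) (E : economy R) (i : student E) :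
    seq (school E) :=
  sort (fun s t => utility i t <= utility i s)
    [seq s <- enum (school E) | 0 < utility i s].

Definition matched_to (I S : finType) (mu : I -> option S) (s : S) : {set I} :=
  [set i | mu i == Some s].

(* [mech rol cap p] is computed from the rank order lists, the capacities and
   the realized priorities alone; [None] means unmatched. *)
Record mechanism (R : realType) := Mechanism {
  mech :> forall I S : finType,
    (I -> seq S) -> (S -> nat) -> (I -> S -> R) -> I -> option S;
  mech_feasible : forall (I S : finType) (rol : I -> seq S) (cap : S -> nat)
    (p : I -> S -> R) (s : S),
    (#|matched_to (mech rol cap p) s| <= cap s)%N
}.

Definition outcome (R : realType) (M : mechanism R) (E : economy R)
    (a : action_profile E) : student E -> option (school E) :=
  M _ _ (@rank_order_list R E) (@capacity R E) (realized_priority a).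

(* [q] is the score with which the priorities of students are compared. *)
Definition envy (R : realType) (E : economy R) (q : student E -> school E -> R)
    (mu : student E -> option (school E)) (i : student E) (s : school E) : Prop :=
  oapp (utility i) 0 (mu i) < utility i s /\
  ((#|matched_to mu s| < capacity s)%N \/
   exists j : student E, mu j = Some s /\ q j s < q i s).

(* A profile of preferences is the profile of utilities of an economy, so that
   quantifying over economies covers all preference profiles. *)
Definition eliminates_justified_envy (R : realType) (M : mechanism R) : Prop :=
  forall (E : economy R) (a : action_profile E),
    ~ exists i s, envy (realized_priority a) (outcome M a) i s.

Definition eliminates_invariant_justified_envy (R : realType)
    (M : mechanism R) : Prop :=
  forall (E : economy R) (a : action_profile E),
    ~ exists i s, envy (@exog_score R E) (outcome M a) i s.

(* A strict total order on every set of students, fixed independently of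
   preferences, capacities and scores; [tie_order i j] means that [i] wins ties
   against [j]. *)
Record tie_breaker := TieBreaker {
  tie_order :> forall I : finType, rel I;
  tie_irreflexive : forall I : finType, irreflexive (@tie_order I);
  tie_transitive : forall I : finType, transitive (@tie_order I);
  tie_total : forall (I : finType) (i j : I),
    i != j -> tie_order i j || tie_order j i
}.

Section DeferredAcceptance.

Variables (R : realType) (tb : tie_breaker) (I S : finType).
Variables (rol : I -> seq S) (cap : S -> nat) (p : I -> S -> R).

Definition priority_ge (s : S) : rel I := fun i j =>
  (p j s < p i s) || ((p j s == p i s) && ((i == j) || tb I i j)).

Definition choose_top (s : S) (A : {set I}) : {set I} :=
  [set i in take (cap s) (sort (priority_ge s) (enum A))].

(* [(i, s) \in da_rejected st] means that [s] has rejected [i] so far. *)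
Record da_state := DAState {
  da_held : S -> {set I};
  da_rejected : {set I * S}
}.

Definition da_start : da_state := DAState (fun=> set0) set0.

Definition da_proposal (st : da_state) (i : I) : option S :=
  if [exists s, i \in da_held st s] then None
  else ohead [seq s <- rol i | (i, s) \notin da_rejected st].

Definition da_candidates (st : da_state) (s : S) : {set I} :=
  da_held st s :|: [set i | da_proposal st i == Some s].

Definition da_round (st : da_state) : da_state :=
  let kept s := choose_top s (da_candidates st s) in
  DAState kept
    (da_rejected st :|: [set x | x.1 \in da_candidates st x.2 :\: kept x.2]).

Fixpoint da_run (n : nat) (st : da_state) : da_state :=
  if n is n'.+1 then
    let st' := da_round st in
    if da_rejected st' == da_rejected st then st' else da_run n' st'
  else st.

(* Every round but the last adds a pair to [da_rejected], so the bound on the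
   number of rounds is never what stops the procedure. *)
Definition da_final : da_state := da_run (#|I| * #|S|).+1 da_start.

Definition da_matching (i : I) : option S := [pick s | i \in da_held da_final s].

Lemma card_choose_top s A : (#|choose_top s A| <= cap s)%N.
Proof.
rewrite /choose_top cardsE (leq_trans (card_size _)) //.
by rewrite size_take_min geq_minl.
Qed.

Lemma card_da_run n st s :
  (#|da_held st s| <= cap s)%N -> (#|da_held (da_run n st) s| <= cap s)%N.
Proof.
elim: n st => [//|n IHn] st _ /=.
by case: ifP => _; [|apply: IHn]; apply: card_choose_top.
Qed.

Lemma da_feasible s : (#|matched_to da_matching s| <= cap s)%N.
Proof.
apply: (@leq_trans #|da_held da_final s|); last first.
  by apply: card_da_run; rewrite cards0.
apply/subset_leq_card/subsetP => i; rewrite inE /da_matching.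
by case: pickP => // t it /eqP[<-].
Qed.

End DeferredAcceptance.

Definition DA (R : realType) (tb : tie_breaker) : mechanism R :=
  Mechanism (@da_feasible R tb).

(* Main.v *)
(** While DA runs, a school that has rejected some student is full and holds only
    students of weakly higher priority, and a student held at [s] has been
    rejected by every school she lists before [s]. Once no rejection occurs, every
    student is held or has exhausted her list, so a school she would prefer to her
    match has rejected her and gives her no ground for envy.

    The negative part holds for every mechanism that eliminates justified envy:
    with one seat, [w = 1], and two students whose manipulable scores are ordered
    oppositely to their exogenous ones, the seat must go to the student with the
    higher manipulable score, whom the other one then invariantly envies. *)
Require Import Defs.
From mathcomp Require Import all_boot all_order all_algebra.
From mathcomp Require Import reals.

Set Implicit Arguments.
Unset Strict Implicit.
Unset Printing Implicit Defensive.

Import Order.TTheory GRing.Theory Num.Theory.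
Local Open Scope ring_scope.

Lemma ohead_filter_index (T : eqType) (P : pred T) (s : seq T) (x : T) :
  ohead (filter P s) = Some x ->
  [/\ x \in s, P x & forall y, y \in s -> P y -> (index x s <= index y s)%N].
Proof.
elim: s => [//|z s IHs] /=; case: ifPn => [Pz [<-]|nPz /IHs[xs Px xmin]].
  by split=> // [|y _ _]; rewrite ?mem_head // eqxx.
split=> // [|y]; first by rewrite inE xs orbT.
rewrite inE => /predU1P[->|ys] Py; first by rewrite Py in nPz.
have zy : z == y = false by apply/eqP => zy; rewrite zy Py in nPz.
by rewrite zy; case: ifP => // _; apply: xmin.
Qed.

Section DeferredAcceptanceTheory.

Variables (R : realType) (tb : tie_breaker) (I S : finType).
Variables (rol : I -> seq S) (cap : S -> nat) (p : I -> S -> R).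

Local Notation choose_top := (choose_top tb cap p).
Local Notation da_round := (da_round tb rol cap p).
Local Notation da_run := (da_run tb rol cap p).
Local Notation da_final := (da_final tb rol cap p).
Local Notation da_matching := (da_matching tb rol cap p).

(** * Choice of a school among its candidates *)

Lemma priority_ge_total (s : S) : total (priority_ge tb p s).
Proof.
move=> i j; rewrite /priority_ge; case: ltgtP => //= _.
by have [//|/(tie_total tb)] := eqVneq i j.
Qed.

Lemma choose_top_sub s (A : {set I}) : choose_top s A \subset A.
Proof.
apply/subsetP => i; rewrite inE => /mem_take.
by rewrite mem_sort mem_enum.
Qed.

Lemma card_choose_topE s (A : {set I}) : #|choose_top s A| = minn (cap s) #|A|.
Proof.
rewrite /Defs.choose_top cardsE (card_uniqP _) ?take_uniq ?sort_uniq ?enum_uniq //.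
by rewrite size_take_min size_sort cardE.
Qed.

Lemma choose_top_ge s (A : {set I}) i j :
  i \in A -> i \notin choose_top s A -> j \in choose_top s A -> p i s <= p j s.
Proof.
set r := sort (priority_ge tb p s) (enum A).
(* [priority_ge] refines the weak order of scores. Passing to that order, whose transitivity is
   immediate, turns sortedness into a pairwise comparison, so the cut at [cap s] separates kept from
   dropped students. *)
have r_sorted : sorted (fun i j => p j s <= p i s) r.
  apply: sub_sorted (sort_sorted (@priority_ge_total s) _) => x y.
  by case/orP => [/ltW//|/andP[/eqP-> _]].
have {r_sorted} : pairwise (fun i j => p j s <= p i s) r.
  rewrite -sorted_pairwise // => x y z yx zy; exact: (le_trans zy yx).
rewrite -{1}(cat_take_drop (cap s) r) pairwise_cat => /and3P[/allrelP take_ge _ _].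
move=> iA; rewrite !inE => i_ntake j_take; apply: take_ge => //.
have: i \in r by rewrite mem_sort mem_enum.
by rewrite -{1}(cat_take_drop (cap s) r) mem_cat (negPf i_ntake).
Qed.

(** * The invariant of the DA rounds *)

Definition best_unrejected (rej : {set I * S}) (i : I) (s : S) : Prop :=
  [/\ s \in rol i, (i, s) \notin rej & forall t, t \in rol i ->
       (i, t) \notin rej -> (index s (rol i) <= index t (rol i))%N].

Record da_invariant (st : da_state I S) : Prop := DAInvariant {
  held_best : forall i s, i \in da_held st s ->
    best_unrejected (da_rejected st) i s;
  rejected_full : forall i s, (i, s) \in da_rejected st ->
    (cap s <= #|da_held st s|)%N;
  rejected_le : forall i s j, (i, s) \in da_rejected st -> j \in da_held st s ->
    p i s <= p j s
}.

Lemma da_start_invariant : da_invariant (da_start I S).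
Proof. by split=> i s; rewrite inE. Qed.

Lemma held_inj st i s t : da_invariant st ->
  i \in da_held st s -> i \in da_held st t -> s = t.
Proof.
move=> inv /(held_best inv)[s_rol s_nrej s_best] /(held_best inv)[t_rol t_nrej t_best].
by apply: (index_inj s s_rol t_rol); apply/eqP; rewrite eqn_leq s_best // t_best.
Qed.

(** [da_proposal] picks the first unrejected school of the list, which is what the invariant says of
    a held student; later arguments need not tell the two kinds of candidates apart. *)
Lemma da_candidate_best st i s : da_invariant st ->
  i \in da_candidates rol st s -> best_unrejected (da_rejected st) i s.
Proof.
move=> inv; rewrite !inE => /orP[/(held_best inv)//|/eqP].
by rewrite /da_proposal; case: ifPn => // _ /ohead_filter_index.
Qed.

(** A fresh rejection is settled by [choose_top] alone. An older one needs the invariant, since the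
    newcomers kept in this round were not compared with [i]. *)
Lemma da_round_rejectedP st i s : da_invariant st ->
  (i, s) \in da_rejected (da_round st) ->
  [/\ (cap s <= #|da_candidates rol st s|)%N &
      forall j, j \in da_held (da_round st) s -> p i s <= p j s].
Proof.
move=> inv; rewrite inE => /orP[rej|]; last first.
  rewrite inE => /setDP[i_cand i_out]; split=> [|j]; last exact: choose_top_ge.
  (* With fewer candidates than seats, all of them would be kept. *)
  rewrite leqNgt; apply: contra i_out => /ltnW card_le.
  suff /eqP-> : choose_top s (da_candidates rol st s) == da_candidates rol st s.
    exact: i_cand.
  by rewrite eqEcard choose_top_sub card_choose_topE leq_min card_le leqnn.
have full := rejected_full inv rej.
have held_cand : da_held st s \subset da_candidates rol st s by apply: subsetUl.
split=> [|j j_kept]; first exact: leq_trans full (subset_leq_card held_cand).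
have [/(rejected_le inv rej)//|j_unheld] := boolP (j \in da_held st s).
(* The newcomer [j] has displaced some held student [k]. *)
have /subsetPn[k k_held k_out] :
    ~~ (da_held st s \subset choose_top s (da_candidates rol st s)).
  (* The seats of [s] were already filled: if all held students stayed, none would be left for
     [j]. *)
  apply: contra j_unheld => sub.
  suff /eqP-> : da_held st s == choose_top s (da_candidates rol st s).
    exact: j_kept.
  by rewrite eqEcard sub (leq_trans (card_choose_top _ _ _ _ _)).
apply: le_trans (rejected_le inv rej k_held) _.
by apply: choose_top_ge k_out j_kept; apply: (subsetP held_cand).
Qed.

Lemma da_round_invariant st : da_invariant st -> da_invariant (da_round st).
Proof.
move=> inv; split=> [i s i_kept|i s|i s j].
- have i_cand := subsetP (choose_top_sub _ _) _ i_kept.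
  have [s_rol s_nrej s_best] := da_candidate_best inv i_cand.
  (* The rejected set only grows, so fewer schools compete with [s]; the pair [(i, s)] does not
     enter it because [i] is kept. *)
  split=> // [|t t_rol]; last by rewrite inE negb_or => /andP[/s_best-> //].
  by rewrite inE negb_or s_nrej; apply/negP; rewrite inE => /setDP[_ /negP[]].
- move=> /(da_round_rejectedP inv)[le_cap _].
  by rewrite card_choose_topE leq_min leqnn.
- by move=> /(da_round_rejectedP inv)[_]; apply.
Qed.

(** * Termination and the final matching *)

Lemma da_run_stops n st : da_invariant st ->
  (#|I| * #|S| < n + #|da_rejected st|)%N ->
  exists st', [/\ da_invariant st', da_run n st = da_round st' &
                  da_rejected (da_round st') = da_rejected st'].
Proof.
elim: n st => [|n IHn] st inv bound.
  by move: bound; rewrite add0n -card_prod ltnNge max_card.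
rewrite /=; case: ifPn => [/eqP stop|go]; first by exists st.
apply: IHn; first exact: da_round_invariant.
(* The unit of fuel spent is offset by at least one new rejected pair, so the bound survives; at
   zero fuel it would ask for more rejected pairs than there are pairs. *)
apply: leq_trans bound _; rewrite addSnnS leq_add2l proper_card //.
by rewrite properEneq eq_sym go subsetUl.
Qed.

Lemma da_final_stops : exists st, [/\ da_invariant st, da_final = da_round st &
  da_rejected (da_round st) = da_rejected st].
Proof.
by apply: da_run_stops da_start_invariant _; rewrite cards0 addn0.
Qed.

Lemma da_final_invariant : da_invariant da_final.
Proof.
by have [st [inv -> _]] := da_final_stops; apply: da_round_invariant.
Qed.

(** The last round rejects nobody new, so it keeps every candidate. A student left unheld was
    therefore no candidate: she made no proposal, having exhausted her list. *)
Lemma da_final_unheld i t : (forall s, i \notin da_held da_final s) ->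
  t \in rol i -> (i, t) \in da_rejected da_final.
Proof.
have [st [inv -> stop]] := da_final_stops => unheld t_rol.
have noncand s : i \notin da_candidates rol st s.
  apply/negP => i_cand; have [_ /negP i_nrej _] := da_candidate_best inv i_cand.
  apply: i_nrej; rewrite -stop; apply/setUP; right; rewrite inE; apply/setDP.
  by split; last exact: unheld.
rewrite stop; apply/negPn/negP => t_nrej.
have : da_proposal rol st i = None.
  case E: (da_proposal rol st i) => [s|//].
  by have /negP[] := noncand s; rewrite !inE E eqxx orbT.
rewrite /da_proposal; case: existsP => [[s s_held]|_].
  by have /negP[] := noncand s; rewrite !inE s_held.
have : t \in [seq s <- rol i | (i, s) \notin da_rejected st].
  by rewrite mem_filter t_nrej.
by case: [seq _ <- _ | _].
Qed.

Lemma da_matchingP i s : reflect (da_matching i = Some s) (i \in da_held da_final s).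
Proof.
apply: (iffP idP) => [s_held|]; rewrite /Defs.da_matching; case: pickP => //.
- by move=> t /held_inj; move/(_ _ da_final_invariant s_held) ->.
- by move=> /(_ s); rewrite s_held.
- by move=> t t_held [<-].
Qed.

Lemma matched_to_da s : matched_to da_matching s = da_held da_final s.
Proof. by apply/setP => i; rewrite inE; apply/eqP/da_matchingP. Qed.

Lemma da_rejected_no_envy i s : (i, s) \in da_rejected da_final ->
  (cap s <= #|matched_to da_matching s|)%N /\
  forall j, da_matching j = Some s -> p i s <= p j s.
Proof.
move=> rej; rewrite matched_to_da; split; first exact: (rejected_full da_final_invariant rej).
by move=> j /da_matchingP; apply: (rejected_le da_final_invariant rej).
Qed.

Lemma da_preferred_rejected i s : s \in rol i ->
  (forall t, da_matching i = Some t -> (index s (rol i) < index t (rol i))%N) ->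
  (i, s) \in da_rejected da_final.
Proof.
move=> s_rol s_pref; case E: (da_matching i) => [t|].
  have /da_matchingP/(held_best da_final_invariant)[_ _ t_best] := E.
  apply/negPn/negP => /(t_best s s_rol).
  by rewrite leqNgt s_pref.
apply: da_final_unheld => // t; apply/negP => /da_matchingP.
by rewrite E.
Qed.

Lemma da_matching_rol i s : da_matching i = Some s -> s \in rol i.
Proof. by move=> /da_matchingP/(held_best da_final_invariant)[]. Qed.

End DeferredAcceptanceTheory.

(** * From list positions to utilities and envy *)

Lemma mem_rank_order_list (R : realType) (E : economy R) (i : student E) s :
  (s \in rank_order_list i) = (0 < utility i s).
Proof. by rewrite mem_sort mem_filter mem_enum andbT. Qed.

Lemma rank_order_list_index (R : realType) (E : economy R) (i : student E) s t :
  s \in rank_order_list i -> t \in rank_order_list i ->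
  utility i t < utility i s ->
  (index s (rank_order_list i) < index t (rank_order_list i))%N.
Proof.
move=> s_rol t_rol lt_ts; rewrite ltnNge; apply/negP => le_ts.
have ge_trans : transitive (fun s t => utility i t <= utility i s).
  by move=> x y z yx zy; exact: (le_trans zy yx).
have ge_total : total (fun s t => utility i t <= utility i s).
  by move=> x y; exact: le_total.
have rol_sorted : sorted (fun s t => utility i t <= utility i s) (rank_order_list i).
  exact: sort_sorted.
have: utility i s <= utility i t.
  exact: (sorted_leq_index ge_trans _ rol_sorted).
by rewrite leNgt lt_ts.
Qed.

Lemma DA_eliminates_justified_envy (R : realType) (tb : tie_breaker) :
  eliminates_justified_envy (DA R tb).
Proof.
move=> E a [i [s [s_pref s_envy]]].
suff [full top] : (capacity s <= #|matched_to (outcome (DA R tb) a) s|)%N /\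
    forall j, outcome (DA R tb) a j = Some s ->
      realized_priority a i s <= realized_priority a j s.
  case: s_envy => [|[j [/top le_ij]]]; first by rewrite ltnNge full.
  by rewrite ltNge le_ij.
have out_rol t : outcome (DA R tb) a i = Some t -> t \in rank_order_list i.
  exact: da_matching_rol.
(* The outcome never has negative utility: it is worth 0 when unmatched, and a listed school is
   acceptable. A school preferred to it is thus worth more than 0, hence listed. *)
have s_rol : s \in rank_order_list i.
  rewrite mem_rank_order_list; apply: le_lt_trans s_pref.
  case out: (outcome _ _ _) => [t|//] /=.
  by apply: ltW; rewrite -mem_rank_order_list out_rol.
apply/da_rejected_no_envy/da_preferred_rejected => // t out_t.
apply: rank_order_list_index => //; first exact: out_rol.
by move: s_pref; rewrite /outcome /= out_t.
Qed.

(** * An economy whose two score orders conflict *)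

Section Reversal.

Variable R : realType.

Let bool_score01 (b : bool) : 0 <= (b%:R : R) <= 1.
Proof. by rewrite ler0n lern1 leq_b1. Qed.

Let manip01 : 0 <= (1 : R) <= 1.
Proof. exact: bool_score01 true. Qed.

Let two_actions (i : bool) : exists a b : bool, a <> b.
Proof. by exists true, false. Qed.

Let unit_utility_inj (i : bool) : injective (fun _ : unit => 1 : R).
Proof. by move=> [] []. Qed.

(** The manipulable scores are constant in the action, so the conflict arises under every action
    profile; [w = 1] makes them the realized priorities. *)
Definition reversal_economy : economy R := @Economy R bool unit
  (fun=> 1%N) 1 1 (fun=> bool) (fun=> false)
  (fun _ _ => 1) (fun i _ => (~~ i)%:R) (fun i _ _ => (i : bool)%:R)
  manip01 ltr01 two_actions unit_utility_inj
  (fun i _ => bool_score01 (~~ i)) (fun i _ _ => bool_score01 i).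

Lemma justified_envy_free_invariant_envy (M : mechanism R) :
  eliminates_justified_envy M -> ~ eliminates_invariant_justified_envy M.
Proof.
pose a : action_profile reversal_economy := fun=> false.
move=> /(_ reversal_economy a) no_envy /(_ reversal_economy a); apply.
set mu := outcome M a in no_envy *.
have prio i : realized_priority a i tt = (i : bool)%:R.
  by rewrite /realized_priority /= mul1r subrr mul0r addr0.
have seat : (#|matched_to mu tt| <= 1)%N := mech_feasible M _ (@capacity _ _) _ _.
have mu_true : mu true = Some tt.
  (* Were [true] unmatched, the seat would be either vacant or held by [false], whose realized
     priority is 0 against 1; both are justified envy. *)
  case out: (mu true) => [[]//|]; case: no_envy; exists true, tt.
  split; first by rewrite out /= ltr01.
  have [->|[j]] := set_0Vmem (matched_to mu tt); first by left; rewrite cards0.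
  rewrite inE => /eqP out_j; right; exists j; split=> //.
  by case: j out_j => [|_]; [rewrite out | rewrite !prio ltr01].
have mu_false : mu false = None.
  case out: (mu false) => [[]|//].
  have /card_le1_eqP/(_ true false) := seat.
  by rewrite !inE mu_true out eqxx => /(_ isT isT).
exists false, tt; split; first by rewrite mu_false /= ltr01.
by right; exists true; split=> //=; rewrite ltr01.
Qed.

End Reversal.

Theorem proposition2 (R : realType) (tb : tie_breaker) :
  eliminates_justified_envy (DA R tb) /\
  ~ eliminates_invariant_justified_envy (DA R tb).
Proof.
have elim := @DA_eliminates_justified_envy R tb; split=> //.
exact: justified_envy_free_invariant_envy.
Qed.
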